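(* Let $\alpha,\beta$ be real numbers with $0\le\alpha\le\beta$. There exists a constant $c$ depending on $\alpha,\beta$ such that for every $f\in C([0,1])$, every $x\in[0,1]$ and every $n\in\mathbb{N}$, $$\left|B_n^{\alpha,\beta}(f;x)-f(x)\right|\le c\cdot\omega\left(f;n^{-1/2}\right).$$
   Context: $C([0,1])$ denotes the set of continuous functions $f:[0,1]\to\mathbb{R}$, and $\mathbb{N}=\{1,2,3,\ldots\}$. For real numbers $0\le\alpha\le\beta$, $n\in\mathbb{N}$, $f:[0,1]\to\mathbb{R}$ and $x\in[0,1]$, the Bernstein-Stancu operator is $$B_n^{\alpha,\beta}(f;x)=\sum_{k=0}^n b_{n,k}(x)\,f\left(\frac{k+\alpha}{n+\beta}\right),\qquad b_{n,k}(x)=\binom{n}{k}x^k(1-x)^{n-k}.$$ For $f\in C([0,1])$ and $\delta>0$, the modulus of continuity of $f$ is $$\omega(f;\delta)=\max\left\{|f(x_1)-f(x_2)| : x_1,x_2\in[0,1],\ |x_1-x_2|\le\delta\right\}.$$ *)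

(* Defs.v *)
From mathcomp Require Import all_boot all_order all_algebra.
From mathcomp Require Import all_classical all_reals all_analysis.

Set Implicit Arguments.
Unset Strict Implicit.
Unset Printing Implicit Defensive.

Import Order.TTheory GRing.Theory Num.Theory.
Import numFieldNormedType.Exports.

Local Open Scope classical_set_scope.
Local Open Scope ring_scope.

Definition bernstein_basis (R : realType) (n k : nat) (x : R) : R :=
  'C(n, k)%:R * x ^+ k * (1 - x) ^+ (n - k).

(* A function on [0, 1] is represented by [f : R -> R], of which only the values
   on [0, 1] matter: for 0 <= alpha <= beta and 0 < n, the nodes
   (k + alpha) / (n + beta) lie in [0, 1]. *)
Definition bernstein_stancu (R : realType) (alpha beta : R) (n : nat)
    (f : R -> R) (x : R) : R :=
  \sum_(0 <= k < n.+1)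
    bernstein_basis n k x * f ((k%:R + alpha) / (n%:R + beta)).

Definition oscillations (R : realType) (f : R -> R) (delta : R) : set R :=
  [set r | exists x1 x2 : R,
    [/\ x1 \in `[0, 1], x2 \in `[0, 1], `|x1 - x2| <= delta
      & r = `|f x1 - f x2|]].

(* [sup] is used as a total operator; for f continuous on [0, 1] and
   0 < delta it is a maximum, see [modulus_max]. *)
Definition modulus (R : realType) (f : R -> R) (delta : R) : R :=
  sup (oscillations f delta).

Lemma modulus_max (R : realType) (f : R -> R) (delta : R) :
  {within `[0, 1], continuous f} -> 0 < delta ->
  oscillations f delta (modulus f delta) /\
  ubound (oscillations f delta) (modulus f delta).
Proof.
move=> cf d0.
pose K : set (R * R) :=
  (`[0, 1] `*` `[0, 1]) `&` [set p | `|p.1 - p.2| <= delta].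
have cK : compact K.
  apply: compact_closedI; first by apply: compact_setX; exact: segment_compact.
  apply: (@preimage_closed _ _ (fun p : R * R => `|p.1 - p.2|)
    [set y | y <= delta]); last exact: closed_le.
  by move=> p _; apply: cvg_norm; apply: cvgB; [exact: cvg_fst|exact: cvg_snd].
have K0 : K !=set0.
  exists (0, 0); split => /=; last by rewrite subrr normr0 ltW.
  by split; rewrite /= in_itv /= lexx ler01.
have cg : {within K, continuous (fun p : R * R => `|f p.1 - f p.2|)}.
  apply/subspace_continuousP => -[a b] [[/= a01 b01] _].
  move/subspace_continuousP in cf.
  have KW1 : (fun p : R * R => p.1) @ within K (nbhs (a, b)) -->
      within `[0, 1] (nbhs a).
    move=> A; rewrite /within /= => nA.
    have /(_ _ nA) : (fun p : R * R => p.1) @ nbhs (a, b) --> nbhs a.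
      exact: cvg_fst.
    by apply: (@filterS _ (nbhs (a, b)) _) => -[u v] /= h [[u01 _] _]; exact: h.
  have KW2 : (fun p : R * R => p.2) @ within K (nbhs (a, b)) -->
      within `[0, 1] (nbhs b).
    move=> A; rewrite /within /= => nA.
    have /(_ _ nA) : (fun p : R * R => p.2) @ nbhs (a, b) --> nbhs b.
      exact: cvg_snd.
    by apply: (@filterS _ (nbhs (a, b)) _) => -[u v] /= h [[_ v01] _]; exact: h.
  apply: cvg_norm; apply: cvgB.
    exact: (cvg_comp _ _ KW1 (cf _ a01)).
  exact: (cvg_comp _ _ KW2 (cf _ b01)).
have [[a b] /set_mem[[/= a01 b01] abd] maxab] := compact_EVT_max K0 cK cg.
have oab : oscillations f delta `|f a - f b| by exists a, b.
have uab : ubound (oscillations f delta) `|f a - f b|.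
  move=> _ [x1 [x2 [x101 x201 x12 ->]]].
  by apply: (maxab (x1, x2)); apply/mem_set.
suff -> : modulus f delta = `|f a - f b| by [].
apply/eqP; rewrite eq_le; apply/andP; split.
  by apply: ge_sup => //; exists `|f a - f b|.
by apply: ub_le_sup => //; exists `|f a - f b|.
Qed.

(* Main.v *)
(* The nodes (k + alpha) / (n + beta) have second moment O(1 / n) about x with
   respect to the weights b_{n,k}(x).  On the other hand, walking from s to t in
   steps of length at most d gives |f t - f s| <= (1 + (t - s)^2 / d^2) w(f; d),
   so averaging this bound with d^2 = 1 / n yields the estimate. *)
Require Import Defs.
From mathcomp Require Import all_boot all_order all_algebra.
From mathcomp Require Import all_classical all_reals all_analysis.
From mathcomp Require Import ring lra.

Set Implicit Arguments.
Unset Strict Implicit.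
Unset Printing Implicit Defensive.

Import Order.TTheory GRing.Theory Num.Theory.
Import numFieldNormedType.Exports.

Local Open Scope classical_set_scope.
Local Open Scope ring_scope.

Lemma bernstein_basis_ge0 (R : realType) (n k : nat) (x : R) :
  0 <= x <= 1 -> 0 <= bernstein_basis n k x.
Proof.
move=> /andP[x0 x1]; rewrite /bernstein_basis.
by rewrite !mulr_ge0 ?exprn_ge0 ?subr_ge0.
Qed.

Lemma bernstein_basisS0 (R : realType) (n : nat) (x : R) :
  bernstein_basis n.+1 0 x = (1 - x) * bernstein_basis n 0 x.
Proof. by rewrite /bernstein_basis !bin0 !expr0 !mul1r !subn0 exprS. Qed.

Lemma bernstein_basisSS (R : realType) (n k : nat) (x : R) : (k <= n)%N ->
  bernstein_basis n.+1 k.+1 x =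
  (1 - x) * bernstein_basis n k.+1 x + x * bernstein_basis n k x.
Proof.
(* Pascal's rule. The case [k = n] is separate because [n - k.+1] truncates there; the binomial
   factor ['C(n, n.+1)] kills that term. *)
rewrite /bernstein_basis binS natrD subSS leq_eqVlt => /predU1P[->|kn].
  by rewrite bin_small// exprS; ring.
by rewrite -(subnSK kn) !exprS; ring.
Qed.

Lemma bernstein_basis_big (R : realType) (n k : nat) (x : R) :
  (n < k)%N -> bernstein_basis n k x = 0.
Proof. by move=> nk; rewrite /bernstein_basis bin_small// !mul0r. Qed.

(** In binomial terms, this conditions on one of [n.+1] trials: it fails with probability [1 - x],
    or succeeds and shifts the count by one. It drives the inductions for the moments. *)
Lemma bernstein_sumS (R : realType) (n : nat) (x : R) (g : nat -> R) :
  \sum_(0 <= k < n.+2) bernstein_basis n.+1 k x * g k =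
  (1 - x) * (\sum_(0 <= k < n.+1) bernstein_basis n k x * g k) +
  x * (\sum_(0 <= k < n.+1) bernstein_basis n k x * g k.+1).
Proof.
(* Padding with the zero term at [k = n.+1] aligns the range with that of the left-hand side. *)
have -> : \sum_(0 <= k < n.+1) bernstein_basis n k x * g k =
          \sum_(0 <= k < n.+2) bernstein_basis n k x * g k.
  by rewrite [RHS]big_nat_recr//= bernstein_basis_big// mul0r addr0.
rewrite !(big_nat_recl n.+1)//= bernstein_basisS0 mulrDr -addrA.
congr (_ + _); rewrite ?mulrA// !mulr_sumr -big_split/=.
by apply: eq_big_nat => k /andP[_ kn]; rewrite bernstein_basisSS//; ring.
Qed.

Lemma bernstein_sum1 (R : realType) (n : nat) (x : R) :
  \sum_(0 <= k < n.+1) bernstein_basis n k x = 1.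
Proof.
under eq_bigr do rewrite -[bernstein_basis _ _ _]mulr1.
elim: n => [|n IHn]; last by rewrite (bernstein_sumS _ _ (fun=> 1)) IHn; ring.
by rewrite big_nat1 /bernstein_basis bin0 !expr0 !mulr1.
Qed.

(* Allowing an arbitrary centre a is what makes the induction on n go through. *)
Lemma bernstein_sum_sqr (R : realType) (n : nat) (x a : R) :
  \sum_(0 <= k < n.+1) bernstein_basis n k x * (k%:R - a) ^+ 2 =
  n%:R * x * (1 - x) + (n%:R * x - a) ^+ 2.
Proof.
elim: n a => [|n IHn] a.
  by rewrite big_nat1 /bernstein_basis bin0 !expr0; ring.
rewrite (bernstein_sumS _ _ (fun k => (k%:R - a) ^+ 2)) IHn.
have -> : \sum_(0 <= k < n.+1) bernstein_basis n k x * (k.+1%:R - a) ^+ 2 =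
          \sum_(0 <= k < n.+1) bernstein_basis n k x * (k%:R - (a - 1)) ^+ 2.
  by apply: eq_bigr => k _; rewrite -natr1; congr (_ * _ ^+ 2); ring.
by rewrite IHn -natr1; ring.
Qed.

(** Each node differs from [x] by [(k - a) / (n + beta)] for one fixed centre [a], so this is the
    second moment about [a], rescaled. *)
Lemma bernstein_stancu_sqr_dist (R : realType) (alpha beta x : R) (n : nat) :
  n%:R + beta != 0 ->
  bernstein_stancu alpha beta n (fun t => (t - x) ^+ 2) x =
  (n%:R * x * (1 - x) + (alpha - beta * x) ^+ 2) / (n%:R + beta) ^+ 2.
Proof.
move=> nb0; pose a := (n%:R + beta) * x - alpha.
have -> : alpha - beta * x = n%:R * x - a by rewrite /a; ring.
rewrite -bernstein_sum_sqr mulr_suml; apply: eq_bigr => k _ /=.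
by rewrite /a; field.
Qed.

Lemma dist_le_modulus (R : realType) (f : R -> R) (d s t : R) :
  {within `[0, 1], continuous f} -> 0 < d ->
  s \in `[0, 1] -> t \in `[0, 1] -> `|s - t| <= d ->
  `|f s - f t| <= modulus f d.
Proof.
by move=> cf d0 s01 t01 st; apply: (modulus_max cf d0).2; exists s, t.
Qed.

Lemma modulus_ge0 (R : realType) (f : R -> R) (d : R) :
  {within `[0, 1], continuous f} -> 0 < d -> 0 <= modulus f d.
Proof. by move=> cf d0; have [[s [t [_ _ _ ->]]] _] := modulus_max cf d0. Qed.

Lemma dist_le_mul_modulus (R : realType) (f : R -> R) (d s t : R) (m : nat) :
  {within `[0, 1], continuous f} -> 0 < d ->
  s \in `[0, 1] -> t \in `[0, 1] -> `|s - t| <= m%:R * d ->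
  `|f s - f t| <= m%:R * modulus f d.
Proof.
move=> cf d0 s01; elim: m t => [|m IHm] t t01.
  by rewrite !mul0r !normr_le0 !subr_eq0 => /eqP ->.
(* [u] ends the first [m] of [m.+1] equal steps from [s] to [t]. *)
move=> std; pose u := s + (t - s) * (m%:R / m.+1%:R).
have m1 : 0 < m.+1%:R :> R by rewrite ltr0n.
have q0 : 0 <= m%:R / m.+1%:R :> R by rewrite divr_ge0.
have q1 : m%:R / m.+1%:R <= 1 :> R by rewrite ler_pdivrMr// mul1r ler_nat.
have u01 : u \in `[0, 1].
  move: s01 t01; rewrite /u !in_itv/= => /andP[s0 s1] /andP[t0 t1].
  move: (_ / _) q0 q1 => q q0 q1.
  (* [u] is the convex combination of [s] and [t] with weights [1 - q] and [q]; these products make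
     its bounds linear. *)
  have : 0 <= s * (1 - q) by rewrite mulr_ge0// subr_ge0.
  have : 0 <= t * q by rewrite mulr_ge0.
  have : 0 <= (1 - s) * (1 - q) by rewrite mulr_ge0 ?subr_ge0.
  have : 0 <= (1 - t) * q by rewrite mulr_ge0 ?subr_ge0.
  by lra.
have std' : `|s - t| / m.+1%:R <= d by rewrite ler_pdivrMr// mulrC.
have su : `|s - u| <= m%:R * d.
  have -> : s - u = (s - t) / m.+1%:R * m%:R by rewrite /u; field; rewrite gt_eqF.
  by rewrite !normrM normfV !normr_nat mulrC ler_wpM2l.
have ut : `|u - t| <= d.
  have -> : u - t = (s - t) / m.+1%:R.
    by rewrite /u -natr1; field; rewrite natr1 gt_eqF.
  by rewrite normrM normfV normr_nat.
rewrite -natr1 mulrDl mul1r (le_trans (ler_distD (f u) _ _))// lerD ?IHm//.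
exact: dist_le_modulus.
Qed.

Lemma dist_le_sqr_modulus (R : realType) (f : R -> R) (d s t : R) :
  {within `[0, 1], continuous f} -> 0 < d ->
  s \in `[0, 1] -> t \in `[0, 1] ->
  `|f s - f t| <= (1 + (s - t) ^+ 2 / d ^+ 2) * modulus f d.
Proof.
move=> cf d0 s01 t01; pose r := `|s - t| / d; pose m := Num.truncn r.
have r0 : 0 <= r by rewrite divr_ge0// ltW.
have /andP[mr rm] : m%:R <= r < m.+1%:R by exact: truncn_itv.
have w0 := modulus_ge0 cf d0.
have -> : (s - t) ^+ 2 / d ^+ 2 = r ^+ 2.
  by rewrite /r exprMn exprVn real_normK// num_real.
have st : `|s - t| <= m.+1%:R * d by rewrite -ler_pdivrMr// ltW.
apply: (le_trans (dist_le_mul_modulus cf d0 s01 t01 st)).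
(* With [m] the integer part of [r], [m.+1] steps suffice, and [m <= m ^ 2 <= r ^ 2] because [m] is
   a natural number. *)
rewrite ler_wpM2r// -nat1r lerD2l (le_trans _ (_ : m%:R ^+ 2 <= _))//.
  by rewrite -natrX ler_nat -mulnn; case: (m) => // k; rewrite leq_pmull.
by rewrite lerXn2r// ?nnegrE.
Qed.

Theorem corollary2 (R : realType) (alpha beta : R)
    (halpha : 0 <= alpha) (hbeta : alpha <= beta) :
  exists c : R,
    forall f : R -> R, {within `[0, 1], continuous f} ->
    forall x : R, x \in `[0, 1] ->
    forall n : nat, (0 < n)%N ->
      `| bernstein_stancu alpha beta n f x - f x |
        <= c * modulus f (n%:R `^ (- (1 / 2))).
Proof.
(* One unit is the total mass of the weights; [1 + beta ^+ 2] bounds [n] times the second moment of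
   the nodes about [x]. *)
exists (2 + beta ^+ 2) => f cf x x01 n n0.
have beta0 := le_trans halpha hbeta.
have n1 : 1 <= n%:R :> R by rewrite ler1n.
have nb0 : 0 < n%:R + beta by lra.
set d := n%:R `^ _.
have d0 : 0 < d by rewrite powR_gt0 ?ltr0n.
have d2 : (d ^+ 2)^-1 = n%:R.
  rewrite /d -powR_mulrn ?powR_ge0// -powRrM.
  have -> : - (1 / 2) * 2%:R = -1 :> R by field.
  by rewrite powR_inv1// invrK.
have w0 := modulus_ge0 cf d0.
have /andP[x0 x1] : 0 <= x <= 1 by move: x01; rewrite in_itv.
pose t (k : nat) := (k%:R + alpha) / (n%:R + beta).
have t01 k : (k <= n)%N -> t k \in `[0, 1].
  rewrite -(ler_nat R) in_itv/= => kn; have k0 : 0 <= k%:R :> R by [].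
  by rewrite divr_ge0 ?(ltW nb0) ?addr_ge0//= ler_pdivrMr// mul1r lerD.
(* The weights sum to 1, so [f x] can be moved under the sum. *)
have -> : bernstein_stancu alpha beta n f x - f x =
    \sum_(0 <= k < n.+1) bernstein_basis n k x * (f (t k) - f x).
  under [RHS]eq_bigr do rewrite mulrBr.
  by rewrite sumrB -mulr_suml/= bernstein_sum1 mul1r.
apply: (le_trans (ler_norm_sum _ _ _)).
apply: (@le_trans _ _ (\sum_(0 <= k < n.+1) (bernstein_basis n k x +
    bernstein_basis n k x * (t k - x) ^+ 2 * n%:R) * modulus f d)).
  (* The range condition is kept because [t k] is known to lie in the unit interval only for
     [k <= n]. *)
  rewrite big_nat_cond [leRHS]big_nat_cond; apply: ler_sum => k.
  rewrite andbT ltnS => /andP[_ kn].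
  rewrite normrM ger0_norm ?bernstein_basis_ge0 ?x0//.
  have := dist_le_sqr_modulus cf d0 (t01 _ kn) x01; rewrite d2 => tx.
  have -> : forall b u w : R, (b + b * u * n%:R) * w = b * ((1 + u * n%:R) * w).
    by move=> b u w; ring.
  by rewrite ler_wpM2l ?bernstein_basis_ge0 ?x0.
rewrite -mulr_suml ler_wpM2r//= big_split/= bernstein_sum1 -mulr_suml/=.
have := @bernstein_stancu_sqr_dist R alpha beta x n.
rewrite /bernstein_stancu gt_eqF// => ->//.
rewrite mulrAC -[2]/(1 + 1 : R) -addrA lerD2l ler_pdivrMr ?exprn_gt0//.
(* Both [alpha] and [beta * x] lie between 0 and [beta]. *)
have ab2 : (alpha - beta * x) ^+ 2 <= beta ^+ 2.
  have : beta * x <= beta by rewrite ler_piMr.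
  have : 0 <= beta * x by rewrite mulr_ge0.
  by nra.
have xx : n%:R * x * (1 - x) <= n%:R by nra.
(* Since [1 <= n], this middle term is at most [(1 + beta ^+ 2) * n ^ 2], and [n <= n + beta]. *)
apply: (@le_trans _ _ ((n%:R + beta ^+ 2) * n%:R)).
  by rewrite ler_wpM2r// lerD.
have : n%:R ^+ 2 <= (n%:R + beta) ^+ 2 by rewrite lerXn2r// ?nnegrE; lra.
have : 0 <= beta ^+ 2 by rewrite sqr_ge0.
by nra.
Qed.
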